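(* Let $G$ be a finite group and $K$ a finite field of characteristic $p$. Let $C=zKG$, where $z=z^2=\hat z\in KG$, be an LCD, MDS group code in $KG$. Define $S=\{g\in G : z\cdot g=\lambda z \text{ for some } \lambda\in K\}$. Then: 1. $S$ is a subgroup of $G$. 2. $d(C)\geq |S|$.
   Context: For a finite field $K$ and a finite group $G$, $KG=\{\sum_{g\in G}a_g g : a_g\in K\}$ is the group algebra with its usual addition and multiplication. For $a=\sum_g a_g g\in KG$, the adjoint is $\hat a=\sum_g a_g g^{-1}$. A group code is a right ideal $C$ of $KG$, viewed as a linear code of length $n=|G|$ over $K$ with weight $wt(a)=|\{g\in G: a_g\neq 0\}|$. The minimum distance $d(C)$ is the minimum weight of a nonzero element of $C$. The inner product on $KG$ is $\langle a,b\rangle=\sum_{g\in G}a_g b_g$, and $C^\perp=\{b\in KG:\langle a,b\rangle=0\ \forall a\in C\}$. $C$ is LCD (linear complementary dual) if $C\cap C^\perp=\{0\}$. $C$ is MDS (maximum distance separable) if $d(C)=n-\dim_K(C)+1$. *)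

(* Defs.v *)
From HB Require Import structures.
From mathcomp Require Import all_boot all_order all_algebra all_fingroup all_field.

Set Implicit Arguments.
Unset Strict Implicit.
Unset Printing Implicit Defensive.

Import GRing.Theory.
Local Open Scope ring_scope.

(* The alias hides the pointwise product that the library puts on
   {ffun gT -> K}; K^o is K seen as a vector space over itself. *)
Definition group_algebra (K : fieldType) (gT : finGroupType) : Type :=
  {ffun gT -> K^o}.

Section GroupAlgebra.

Variables (K : fieldType) (gT : finGroupType).
Local Notation KG := (group_algebra K gT).
Implicit Types (a b c : KG) (g h : gT).

HB.instance Definition _ := Vector.copy KG {ffun gT -> K^o}.

Definition gcoef a g : K := (a : {ffun gT -> K^o}) g.

Definition galg_elt g : KG := [ffun h => (h == g)%:R].

Definition galg_mul a b : KG :=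
  [ffun g => \sum_(h : gT) gcoef a h * gcoef b (h^-1 * g)%g].

Fact gcoefP a b : gcoef a =1 gcoef b -> a = b.
Proof. by move=> eq_ab; apply/ffunP. Qed.

Fact gcoefD a b g : gcoef (a + b) g = gcoef a g + gcoef b g.
Proof. exact: ffunE. Qed.

Fact gcoefZ (k : K) a g : gcoef (k *: a) g = k * gcoef a g.
Proof. exact: ffunE. Qed.

Fact gcoef_elt g h : gcoef (galg_elt g) h = (h == g)%:R.
Proof. exact: ffunE. Qed.

Fact gcoef_mul a b g :
  gcoef (galg_mul a b) g = \sum_(h : gT) gcoef a h * gcoef b (h^-1 * g)%g.
Proof. exact: ffunE. Qed.

Fact galg_mulA : associative galg_mul.
Proof.
move=> a b c; apply: gcoefP => g; rewrite !gcoef_mul.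
transitivity (\sum_(h : gT) \sum_(k : gT)
    gcoef a h * (gcoef b (h^-1 * k)%g * gcoef c (k^-1 * g)%g)).
  apply: eq_bigr => h _; rewrite gcoef_mul big_distrr /=.
  rewrite (reindex_inj (mulgI h^-1%g)) /=.
  by apply: eq_bigr => k _; rewrite invMg invgK -mulgA mulKVg.
rewrite exchange_big /=; apply: eq_bigr => k _.
by rewrite gcoef_mul big_distrl; apply: eq_bigr => h _; rewrite mulrA.
Qed.

Fact galg_mul1 : left_id (galg_elt 1%g) galg_mul.
Proof.
move=> a; apply: gcoefP => g; rewrite gcoef_mul (bigD1 1%g) //= gcoef_elt eqxx.
rewrite mul1r invg1 mul1g big1 ?addr0 // => h /negPf h1.
by rewrite gcoef_elt h1 mul0r.
Qed.

Fact galg_1mul : right_id (galg_elt 1%g) galg_mul.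
Proof.
move=> a; apply: gcoefP => g; rewrite gcoef_mul (bigD1 g) //= gcoef_elt.
rewrite mulVg eqxx mulr1 big1 ?addr0 // => h hg.
by rewrite gcoef_elt -eq_mulVg1 (negPf hg) mulr0.
Qed.

Fact galg_mulDl : left_distributive galg_mul +%R.
Proof.
move=> a b c; apply: gcoefP => g; rewrite gcoefD !gcoef_mul -big_split /=.
by apply: eq_bigr => h _; rewrite gcoefD mulrDl.
Qed.

Fact galg_mulDr : right_distributive galg_mul +%R.
Proof.
move=> a b c; apply: gcoefP => g; rewrite gcoefD !gcoef_mul -big_split /=.
by apply: eq_bigr => h _; rewrite gcoefD mulrDr.
Qed.

Fact galg_1neq0 : galg_elt 1%g != 0.
Proof.
apply/eqP => /ffunP/(_ 1%g); rewrite !ffunE eqxx => /eqP.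
by rewrite oner_eq0.
Qed.

HB.instance Definition _ := GRing.Zmodule_isNzRing.Build KG
  galg_mulA galg_mul1 galg_1mul galg_mulDl galg_mulDr galg_1neq0.

Fact galg_scaleAl (k : K) a b : k *: (a * b) = (k *: a) * b.
Proof.
apply: gcoefP => g; rewrite gcoefZ !gcoef_mul big_distrr /=.
by apply: eq_bigr => h _; rewrite gcoefZ mulrA.
Qed.

HB.instance Definition _ :=
  GRing.Lmodule_isLalgebra.Build K KG galg_scaleAl.

Fact galg_scaleAr (k : K) a b : k *: (a * b) = a * (k *: b).
Proof.
apply: gcoefP => g; rewrite gcoefZ !gcoef_mul big_distrr /=.
by apply: eq_bigr => h _; rewrite gcoefZ mulrCA.
Qed.

HB.instance Definition _ :=
  GRing.Lalgebra_isAlgebra.Build K KG galg_scaleAr.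

HB.instance Definition _ := Algebra_isFalgebra.Build K KG.

Definition adjoint a : KG := \sum_(g : gT) gcoef a g *: galg_elt g^-1%g.

Definition inner a b : K := \sum_(g : gT) gcoef a g * gcoef b g.

Definition wt a : nat := #|[set g | gcoef a g != 0]|.

(* A right ideal of KG is automatically a K-subspace. *)
Definition group_code (C : {vspace KG}) : Prop :=
  forall c x : KG, c \in C -> c * x \in C.

(* The right ideal z KG: amull z is the K-linear map x |-> z * x. *)
Definition right_ideal_gen (z : KG) : {vspace KG} := limg (amull z).

End GroupAlgebra.

Section Codes.

Variables (K : finFieldType) (gT : finGroupType).
Local Notation KG := (group_algebra K gT).

HB.instance Definition _ := Finite.copy KG {ffun gT -> K^o}.

Implicit Types C : {vspace KG}.

Definition dual_code C : {set KG} := [set b | [forall a in C, inner a b == 0]].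

Definition lcd C : Prop := [set c in C] :&: dual_code C = [set 0].

(* For C = 0 there is no nonzero codeword; the value is then |G| + 1, which
   makes the zero code MDS.  The default is never attained when C != 0,
   because weights are at most |G|. *)
Definition min_dist C : nat :=
  \big[minn/#|gT|.+1]_(c : KG | (c \in C) && (c != 0)) wt c.

Definition mds C : Prop := min_dist C = (#|gT| - \dim C + 1)%N.

Definition scaling_set (z : KG) : {set gT} :=
  [set g | [exists lambda : K, z * galg_elt K g == lambda *: z]].

End Codes.

(* Main.v *)
Require Import Defs.
From mathcomp Require Import all_boot all_order all_algebra all_fingroup all_field.
Local Open Scope ring_scope.

(** If [g] scales [z] on the right, [z g = lambda z], then applying the
    anti-automorphism [adjoint] to this equation, with [adjoint z = z], gives
    [g^-1 z = lambda z]: right scaling becomes left scaling.  The latter passes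
    to every codeword [z x] of [z KG], which is why the support of a codeword
    is stable under left translation by the elements [g^-1], hence by [S]
    ([scaling_shift]).  A nonempty set with this property contains a coset
    [S h], so every nonzero codeword has weight at least [|S|]
    ([scaling_set_leq_wt]).  That [S] is a subgroup is seen by scaling twice;
    in a finite group closure under products suffices. *)

Import GRing.Theory.

Section ScalingSet.

Context {K : finFieldType} {gT : finGroupType}.
Local Notation KG := (group_algebra K gT).
Local Notation elt := (galg_elt K).
Implicit Types (a c x z : KG) (g h : gT).

Lemma galg_eltM g h : elt g * elt h = elt (g * h)%g :> KG.
Proof.
apply: gcoefP => k; rewrite gcoef_mul (bigD1 g) //= big1 => [|i /negPf gi].
  by rewrite !gcoef_elt eqxx mul1r addr0 -(inj_eq (mulgI g)) mulKVg.
by rewrite gcoef_elt gi mul0r.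
Qed.

Lemma gcoef_eltM g a h : gcoef (elt g * a) h = gcoef a (g^-1 * h)%g.
Proof.
rewrite gcoef_mul (bigD1 g) //= big1 => [|i /negPf gi].
  by rewrite gcoef_elt eqxx mul1r addr0.
by rewrite gcoef_elt gi mul0r.
Qed.

Lemma gcoef_Melt a g h : gcoef (a * elt g) h = gcoef a (h * g^-1)%g.
Proof.
rewrite gcoef_mul (bigD1 (h * g^-1)%g) //= big1 => [|i /negPf hi].
  by rewrite gcoef_elt invMg invgK mulgKV eqxx mulr1 addr0.
rewrite gcoef_elt -(inj_eq (mulgI i)) mulKVg -(inj_eq (mulIg g^-1%g)) mulgK.
by rewrite eq_sym hi mulr0.
Qed.

Lemma gcoef0 g : gcoef (0 : KG) g = 0.
Proof. exact: ffunE. Qed.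

Lemma gcoef_adjoint a g : gcoef (adjoint a) g = gcoef a g^-1%g.
Proof.
have gcoef_sum (F : gT -> KG) : gcoef (\sum_h F h) g = \sum_h gcoef (F h) g.
  exact: sum_ffunE.
rewrite gcoef_sum (bigD1 g^-1%g) //= big1 => [|h /negPf hg].
  by rewrite gcoefZ gcoef_elt invgK eqxx mulr1 addr0.
by rewrite gcoefZ gcoef_elt -(inj_eq invg_inj) invgK eq_sym hg mulr0.
Qed.

Lemma adjoint_Melt a g : adjoint (a * elt g) = elt g^-1%g * adjoint a.
Proof.
apply: gcoefP => h; rewrite gcoef_adjoint gcoef_Melt gcoef_eltM gcoef_adjoint.
by rewrite !invMg !invgK.
Qed.

Lemma adjointZ (k : K) a : adjoint (k *: a) = k *: adjoint a.
Proof.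
by apply: gcoefP => h; rewrite gcoef_adjoint !gcoefZ gcoef_adjoint.
Qed.

Lemma scaling_setP z g :
  reflect (exists lambda : K, z * elt g = lambda *: z) (g \in scaling_set z).
Proof. by rewrite inE; apply: (iffP existsP) => -[l /eqP zg]; exists l. Qed.

Lemma group_set_scaling_set z : group_set (scaling_set z).
Proof.
apply/group_setP; split=> [|g h /scaling_setP[l zg] /scaling_setP[m zh]].
  by apply/scaling_setP; exists 1; rewrite scale1r; apply: mulr1.
apply/scaling_setP; exists (l * m).
by rewrite -galg_eltM mulrA zg -scalerAl zh scalerA.
Qed.

(** The factor is nonzero because right multiplication by the unit [g] cannot
    annihilate [z]; this is what preserves supports, not merely zeros. *)
Lemma scaling_shift z g :
    adjoint z = z -> z != 0 -> g \in scaling_set z ->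
  exists2 lambda : K, lambda != 0
    & forall x h, gcoef (z * x) (g * h)%g = lambda * gcoef (z * x) h.
Proof.
move=> z_adj z_neq0 /scaling_setP[l zg]; exists l => [|x h].
  apply: contra_neq z_neq0 => l0; apply: gcoefP => h.
  by rewrite -[h](mulgK g) -gcoef_Melt zg l0 scale0r !gcoef0.
have gz : elt g^-1%g * z = l *: z by rewrite -{1}z_adj -adjoint_Melt zg adjointZ z_adj.
by rewrite -gcoefZ scalerAl -gz -mulrA gcoef_eltM invgK.
Qed.

(** The support contains the whole coset [S h] of any of its points [h]. *)
Lemma scaling_set_leq_wt z c :
    adjoint z = z -> c \in right_ideal_gen z -> c != 0 ->
  (#|scaling_set z| <= wt c)%N.
Proof.
move=> z_adj /memv_imgP[x _ ->]; rewrite lfunE /= => zx_neq0.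
have z_neq0 : z != 0 by apply: contra_neq zx_neq0 => ->; rewrite mul0r.
have [h zxh] : exists h, gcoef (z * x) h != 0.
  apply/existsP; apply: contra_neqT zx_neq0 => /existsPn zx0.
  by apply: gcoefP => h; rewrite gcoef0; apply/eqP/negPn/zx0.
rewrite -(card_rcoset _ h); apply/subset_leq_card/subsetP => _ /rcosetP[g Sg ->].
have [l l_neq0 shift] := scaling_shift z g z_adj z_neq0 Sg.
by rewrite inE shift mulf_neq0.
Qed.

(** The first premise handles the value of [min_dist] at the zero code. *)
Lemma leq_min_dist (C : {vspace KG}) (n : nat) :
    (n <= #|gT|.+1)%N -> (forall c, c \in C -> c != 0 -> (n <= wt c)%N) ->
  (n <= min_dist C)%N.
Proof.
move=> n_le wt_ge; rewrite /min_dist.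
elim/big_ind: _ => // [i j ni nj | c /andP[]]; first by rewrite leq_min ni.
exact: wt_ge.
Qed.

End ScalingSet.

Theorem theorem6 (p : nat) (K : finFieldType) (gT : finGroupType)
    (z : group_algebra K gT) (C : {vspace group_algebra K gT}) :
  p \in [pchar K] ->
  z * z = z -> adjoint z = z -> C = right_ideal_gen z ->
  group_code C -> lcd C -> mds C ->
  group_set (scaling_set z) /\ (#|scaling_set z| <= min_dist C)%N.
Proof.
move=> _ _ z_adj -> _ _ _; split; first exact: group_set_scaling_set.
apply: leq_min_dist => [|c]; first exact/leqW/max_card.
exact: scaling_set_leq_wt.
Qed.
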